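(* Let $A=\sigma(R)\langle x_1,\dots,x_n\rangle$ be a skew PBW extension over a ring $R$, with associated family of endomorphisms $\Sigma=\{\sigma_1,\dots,\sigma_n\}$ of $R$. If $A$ is semicommutative, then $R$ is $\Sigma$-semicommutative.
   Context: Rings are associative with identity; $\mathbb{N}$ includes $0$. A ring $B$ is semicommutative if for all $a,b\in B$, $ab=0$ implies $aBb=0$. Skew PBW extension: $A=\sigma(R)\langle x_1,\dots,x_n\rangle$ is a skew PBW extension over $R$ if (i) $R$ is a subring of $A$ with the same identity; (ii) there are $x_1,\dots,x_n\in A$ such that $A$ is a free left $R$-module with basis $\mathrm{Mon}(A):=\{x^\alpha:=x_1^{\alpha_1}\cdots x_n^{\alpha_n}\mid \alpha=(\alpha_1,\dots,\alpha_n)\in\mathbb{N}^n\}$; (iii) for each $i$ and each $r\in R\setminus\{0\}$ there is $c_{i,r}\in R\setminus\{0\}$ with $x_ir-c_{i,r}x_i\in R$; (iv) for all $1\le i,j\le n$ there is $d_{i,j}\in R\setminus\{0\}$ with $x_jx_i-d_{i,j}x_ix_j\in R+Rx_1+\cdots+Rx_n$. For such $A$, for each $i$ there are an injective ring endomorphism $\sigma_i$ of $R$ and a $\sigma_i$-derivation $\delta_i$ of $R$ (an additive map with $\delta_i(rs)=\sigma_i(r)\delta_i(s)+\delta_i(r)s$) such that $x_ir=\sigma_i(r)x_i+\delta_i(r)$ for all $r\in R$. Put $\Sigma:=\{\sigma_1,\dots,\sigma_n\}$, and for $\alpha\in\mathbb{N}^n$, $\sigma^\alpha:=\sigma_1^{\alpha_1}\circ\cdots\circ\sigma_n^{\alpha_n}$.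 $R$ is $\Sigma$-semicommutative if for all $a,b\in R$, $ab=0$ implies $aR\sigma^\alpha(b)=0$ for every $\alpha\in\mathbb{N}^n\setminus\{0\}$. *)

(* Defs.v *)
From HB Require Import structures.
From mathcomp Require Import all_boot all_order all_algebra.

Set Implicit Arguments.
Unset Strict Implicit.
Unset Printing Implicit Defensive.

Import GRing.Theory.
Local Open Scope ring_scope.

(* [pzRingType] is the class of associative rings with identity, with no
   nontriviality requirement. *)
Definition semicommutative (B : pzRingType) : Prop :=
  forall a b : B, a * b = 0 -> forall r : B, a * r * b = 0.

(* The inclusion of the base ring R in A is an injective ring morphism iota,
   through which A is a left R-module: r acts by left multiplication by
   iota r. *)
Definition left_generating (R A : pzRingType) (iota : R -> A)
    (I : eqType) (e : I -> A) : Prop :=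
  forall f : A, exists (s : seq I) (c : I -> R),
    f = \sum_(i <- s) iota (c i) * e i.

Definition left_independent (R A : pzRingType) (iota : R -> A)
    (I : eqType) (e : I -> A) : Prop :=
  forall (s : seq I) (c : I -> R), uniq s ->
    \sum_(i <- s) iota (c i) * e i = 0 -> forall i, i \in s -> c i = 0.

(* A big product over 'I_n is taken in increasing order of the index. *)
Definition monomial (A : pzRingType) (n : nat) (x : 'I_n -> A)
    (alpha : {ffun 'I_n -> nat}) : A :=
  \prod_(i < n) x i ^+ alpha i.

Record skew_PBW (R A : pzRingType) (iota : {rmorphism R -> A})
    (n : nat) (x : 'I_n -> A) : Prop := SkewPBW {
  skew_PBW_inj : injective iota;
  skew_PBW_generating : left_generating iota (monomial x);
  skew_PBW_independent : left_independent iota (monomial x);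
  skew_PBW_coef : forall (i : 'I_n) (r : R), r != 0 ->
    exists2 c : R, c != 0 &
      exists d : R, x i * iota r - iota c * x i = iota d;
  skew_PBW_var : forall i j : 'I_n,
    exists2 d : R, d != 0 &
      exists (r0 : R) (r : 'I_n -> R),
        x j * x i - iota d * x i * x j =
          iota r0 + \sum_(k < n) iota (r k) * x k
}.

(* Since A is free on the monomials, the commutation rule determines
   sigma and delta uniquely from iota and x. *)
Record skew_PBW_data (R A : pzRingType) (iota : {rmorphism R -> A})
    (n : nat) (x : 'I_n -> A)
    (sigma : 'I_n -> {rmorphism R -> R})
    (delta : 'I_n -> {additive R -> R}) : Prop := SkewPBWData {
  skew_PBW_sigma_inj : forall i : 'I_n, injective (sigma i);
  skew_PBW_deltaM : forall (i : 'I_n) (r s : R),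
    delta i (r * s) = sigma i r * delta i s + delta i r * s;
  skew_PBW_comm : forall (i : 'I_n) (r : R),
    x i * iota r = iota (sigma i r) * x i + iota (delta i r)
}.

(* sigma_1^alpha_1 \o ... \o sigma_n^alpha_n, so that sigma_n^alpha_n is
   applied first. *)
Definition sigma_pow (R : Type) (n : nat) (sigma : 'I_n -> R -> R)
    (alpha : {ffun 'I_n -> nat}) : R -> R :=
  \big[(fun f g : R -> R => f \o g)/id]_(i < n) iter (alpha i) (sigma i).

Definition Sigma_semicommutative (R : pzRingType) (n : nat)
    (sigma : 'I_n -> R -> R) : Prop :=
  forall a b : R, a * b = 0 ->
  forall alpha : {ffun 'I_n -> nat}, alpha != [ffun=> 0%N] ->
  forall r : R, a * r * sigma_pow sigma alpha b = 0.

(* Main.v *)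
Require Import Defs.
From mathcomp Require Import all_boot all_order all_algebra.

(** Let [a * b = 0] in [R].  Since [A] is semicommutative, [a x_i b = 0] in [A].
    Moving [x_i] to the right of [b] turns this into
    [(a sigma_i(b)) x_i + a delta_i(b) = 0], and since [1] and [x_i] are distinct
    members of the basis of [A] over [R], [a sigma_i(b) = 0]
    ([annihilator_sigma]).

    So the right annihilator of [a] in [R] is stable under every [sigma_i],
    hence under every composite [sigma^alpha] ([annihilator_sigma_pow]).  The
    factor [r] between
    [a] and [sigma^alpha(b)] is then inserted by the semicommutativity of [R],
    which it inherits as a subring of [A]. *)

Set Implicit Arguments.
Unset Strict Implicit.
Unset Printing Implicit Defensive.

Import GRing.Theory.
Local Open Scope ring_scope.

Lemma semicommutative_subring (R A : pzRingType) (iota : {rmorphism R -> A}) :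
  injective iota -> semicommutative A -> semicommutative R.
Proof.
move=> iota_inj scA a b ab0 r; apply: iota_inj.
by rewrite !rmorphM rmorph0 scA // -rmorphM ab0 rmorph0.
Qed.

Definition unit_exponent (n : nat) (i : 'I_n) : {ffun 'I_n -> nat} :=
  [ffun j => (j == i) : nat].

Lemma monomial0 (A : pzRingType) (n : nat) (x : 'I_n -> A) :
  monomial x [ffun=> 0%N] = 1.
Proof. by rewrite /monomial big1 // => i _; rewrite ffunE expr0. Qed.

Lemma monomial_unit_exponent (A : pzRingType) (n : nat) (x : 'I_n -> A)
    (i : 'I_n) :
  monomial x (unit_exponent i) = x i.
Proof.
rewrite /monomial (eq_bigr (fun j => if j == i then x j else 1)).
  by rewrite -big_mkcond big_pred1_eq.
by move=> j _; rewrite ffunE; case: eqP => _; rewrite ?expr0 ?expr1.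
Qed.

Lemma unit_exponent_neq0 (n : nat) (i : 'I_n) :
  unit_exponent i != [ffun=> 0%N].
Proof. by apply/eqP => /ffunP/(_ i); rewrite !ffunE eqxx. Qed.

Lemma independent_affine_eq0 (R A : pzRingType) (iota : R -> A) (n : nat)
    (x : 'I_n -> A) (i : 'I_n) (c d : R) :
  left_independent iota (monomial x) ->
  iota c * x i + iota d = 0 -> c = 0.
Proof.
move=> indep cd0; have nz := unit_exponent_neq0 i.
pose s := [:: unit_exponent i; [ffun=> 0%N]].
pose coef k := if k == unit_exponent i then c else d.
have -> : c = coef (unit_exponent i) by rewrite /coef eqxx.
apply: (indep s); rewrite ?mem_head //= ?inE ?nz //.
rewrite !big_cons big_nil addr0 monomial_unit_exponent monomial0 mulr1.
by rewrite /coef eqxx [X in iota (if X then _ else _)]eq_sym (negPf nz).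
Qed.

(** The element [a x_i b] of [A] vanishes, and [a sigma_i(b)] is its coefficient
    at [x_i], because [a delta_i(b)] lies in the component of [1]. *)
Lemma annihilator_sigma (R A : pzRingType) (iota : {rmorphism R -> A})
    (n : nat) (x : 'I_n -> A) (sigma : 'I_n -> {rmorphism R -> R})
    (delta : 'I_n -> {additive R -> R}) (i : 'I_n) (a b : R) :
  left_independent iota (monomial x) ->
  skew_PBW_data iota x sigma delta -> semicommutative A ->
  a * b = 0 -> a * sigma i b = 0.
Proof.
move=> indep hsigma scA ab0.
have axb0 : iota a * x i * iota b = 0.
  by apply: scA; rewrite -rmorphM ab0 rmorph0.
apply: (independent_affine_eq0 (i := i) (d := a * delta i b) indep).
by rewrite !rmorphM -mulrA -mulrDr -(skew_PBW_comm hsigma) mulrA.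
Qed.

Lemma annihilator_sigma_pow (R : pzRingType) (n : nat)
    (sigma : 'I_n -> R -> R) (alpha : {ffun 'I_n -> nat}) (a b : R) :
  (forall i c, a * c = 0 -> a * sigma i c = 0) ->
  a * b = 0 -> a * sigma_pow sigma alpha b = 0.
Proof.
move=> stable; rewrite /sigma_pow; move: b.
apply: (big_ind (fun f : R -> R => forall b, a * b = 0 -> a * f b = 0)) => //.
  by move=> f g stable_f stable_g b ab0 /=; apply/stable_f/stable_g.
by move=> i _ b ab0; elim: (alpha i) => //= k; apply: stable.
Qed.

Theorem proposition4p1 (R A : pzRingType) (iota : {rmorphism R -> A})
    (n : nat) (x : 'I_n -> A)
    (sigma : 'I_n -> {rmorphism R -> R})
    (delta : 'I_n -> {additive R -> R})
    (hA : skew_PBW iota x)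
    (hsigma : skew_PBW_data iota x sigma delta) :
  semicommutative A -> Sigma_semicommutative sigma.
Proof.
move=> scA a b ab0 alpha _ r.
apply: (semicommutative_subring (skew_PBW_inj hA) scA).
apply: annihilator_sigma_pow ab0 => i c.
exact: annihilator_sigma (skew_PBW_independent hA) hsigma scA.
Qed.
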